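(* An idempotent $k$-translatable groupoid of order $n$ with $\gcd(k,n)=1$ is a quasigroup.
   Context: A groupoid is a set with a binary operation $\cdot$. It is idempotent if $x\cdot x=x$ for all $x$. It is a quasigroup if for all elements $a,b$ there exist a unique $x$ with $a\cdot x=b$ and a unique $y$ with $y\cdot a=b$. For an integer $x$, $[x]_n$ denotes the residue of $x$ modulo $n$, represented in $\{1,\ldots,n\}$, with $0$ identified with $n$. All groupoids are finite and taken to be of the form $Q=\{1,\ldots,n\}$ with the natural ordering. For $1\le k<n$, $Q$ is $k$-translatable if in its multiplication table each row $i$, $2\le i\le n$, is obtained from row $i-1$ by cyclically shifting it $k$ places to the right, i.e. $i\cdot j=(i-1)\cdot[j-k]_n$ for all $j$ and all $2\le i\le n$. *)

(* Defs.v *)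
From mathcomp Require Import all_boot all_order all_algebra.
Set Implicit Arguments.
Unset Strict Implicit.
Unset Printing Implicit Defensive.

(* The ordered carrier {1, ..., n} is represented by 'I_n: the ordinal of value
   i stands for the element i + 1, which is its label. *)
Definition label (n : nat) (i : 'I_n) : int := Posz i.+1.

(* [x]_n: residue modulo n with representatives 1, ..., n (n in place of 0). *)
Definition residue (n : nat) (x : int) : int :=
  if (x %% Posz n)%Z == 0%R then Posz n else (x %% Posz n)%Z.

Definition quasigroup (T : Type) (op : T -> T -> T) : Prop :=
  forall a b : T, (exists! x, op a x = b) /\ (exists! y, op y a = b).

(* i . j = (i - 1) . [j - k]_n for every j and every 2 <= i <= n; here i'
   and j' are the elements labelled i - 1 and [j - k]_n.  No i' exists for
   the first row, so 2 <= i is implicit. *)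
Definition translatable (n k : nat) (op : 'I_n -> 'I_n -> 'I_n) : Prop :=
  forall i i' j j' : 'I_n,
    label i' = (label i - 1)%R ->
    label j' = residue n (label j - Posz k)%R ->
    op i j = op i' j'.

(* Main.v *)
Require Import Defs.
From mathcomp Require Import all_boot all_order all_algebra.
From mathcomp Require Import zify.

(** Read the labels [1, ..., n] as the elements [0, ..., n-1] of the ring Z/n.
    Iterating the shift from the first row gives [i . j = f (j - i k)], where
    [f] is that first row (lemma [translatable_first_row]).  Idempotency says
    [f (i - i k) = i], so [f] has a right inverse and, the carrier being finite,
    [f] is injective.  Rows are then injective because [j |-> j - i k] is, and
    columns because [i |-> j - i k] is: [k] is a unit of Z/n since
    [gcd (k, n) = 1].  An injective translation of a finite set is bijective,
    which is what a quasigroup asks for. *)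

Import GRing.Theory.

(** A label already lies in [1, ..., n], hence is its own representative; the
    only one that is not a remainder modulo [n] is [n], standing for 0. *)
Lemma residue_label (n : nat) (i : 'I_n) (x : int) :
  (label i = x %[mod Posz n])%Z -> residue n x = label i.
Proof.
rewrite /residue /label => <-; rewrite modz_nat.
have := ltn_ord i; rewrite leq_eqVlt => /orP[/eqP ->|lt_in].
  by rewrite modnn.
by rewrite modn_small.
Qed.

(** Bridge between the two descriptions of the shift: subtraction of integer
    labels, reduced by [residue], and subtraction in the ring Z/n. *)
Lemma label_subr_nat (n k : nat) (i : 'I_n.+2) :
  (label (i - k%:R)%R = (label i - Posz k)%R %[mod Posz n.+2])%Z.
Proof.
move: (i - k%:R)%R (subrK k%:R%R i) => j /(congr1 val)/=.
rewrite Zp_nat /= modnDmr => def_i.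
apply/eqP; rewrite eqz_mod_dvd; apply/dvdzP; exists (Posz ((j + k) %/ n.+2)).
have := divn_eq (j + k) n.+2; rewrite def_i /label.
move: (_ %/ _) => q; rewrite -PoszM; move: (q * _) => qn; lia.
Qed.

Lemma translatable_succ (n k : nat) (op : 'I_n.+2 -> 'I_n.+2 -> 'I_n.+2)
    (i i' j : 'I_n.+2) :
  translatable k op -> i = i'.+1 :> nat -> op i j = op i' (j - k%:R)%R.
Proof.
move=> htrans def_i; apply: htrans; first by rewrite /label def_i; lia.
by rewrite (residue_label _ (j - k%:R)%R) //; apply: label_subr_nat.
Qed.

(** Induction on [i]: each step up moves the column back by [k], so reaching the
    top row, the zero of Z/n, from row [i] moves it back by [i k]. *)
Lemma translatable_first_row (n k : nat)
    (op : 'I_n.+2 -> 'I_n.+2 -> 'I_n.+2) (i j : 'I_n.+2) :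
  translatable k op -> op i j = op 0%R (j - i * k%:R)%R.
Proof.
move=> htrans; rewrite -[i in RHS]natr_Zp -natrM.
case: i => m /=; elim: m j => [|m IHm] j lt_m.
  by rewrite mul0n subr0; congr (op _ _); apply: val_inj.
rewrite (translatable_succ n k op _ (Ordinal (ltnW lt_m))) // IHm.
by rewrite mulSn natrD opprD addrA.
Qed.

Lemma inj_exists_unique (T : finType) (f : T -> T) (b : T) :
  injective f -> exists! x, f x = b.
Proof.
move=> inj_f; have [g fK gK] := injF_bij inj_f.
by exists (g b); split=> [|x <-].
Qed.

Lemma inj_quasigroup (T : finType) (op : T -> T -> T) :
  (forall a, injective (op a)) -> (forall a, injective (op^~ a)) ->
  quasigroup op.
Proof. by move=> injr injl a b; split; apply: inj_exists_unique. Qed.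

Theorem theorem2p14 (n k : nat) (op : 'I_n -> 'I_n -> 'I_n)
    (hk : (1 <= k < n)%N)
    (hidem : idempotent_op op)
    (htrans : translatable k op)
    (hgcd : gcdn k n = 1%N) :
  quasigroup op.
Proof.
(* [1 <= k < n] forces [2 <= n], so ['I_n] carries the ring Z/n. *)
case: n op hk hidem htrans hgcd => [|[|n]] op hk hidem htrans hgcd; try lia.
have opE i j := translatable_first_row n k op i j htrans.
(* Idempotency, read on the diagonal [i . i = i]. *)
have rowK : cancel (fun i => i - i * k%:R)%R (op 0%R).
  by move=> i; rewrite -opE.
have row_inj : injective (op 0%R) by apply/can_inj/(canF_sym rowK).
have k_unit : (k%:R : 'I_n.+2)%R \is a GRing.unit.
  by rewrite (unitZpE k (isT : 1 < n.+2)%N) /coprime gcdnC hgcd.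
apply: inj_quasigroup => a x y /=.
  by rewrite (opE a x) (opE a y) => /row_inj/addIr.
by rewrite (opE x a) (opE y a) => /row_inj/addrI/oppr_inj/(mulIr k_unit).
Qed.
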